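(* Let $q(x)$ be an irreducible polynomial of degree $n$ over $\mathbb{Q}$ with $n$ real roots $r_1, \dots, r_n$. If all these roots pairwise have common tails, then $n = 2^k 3^m$ for some nonnegative integers $k$ and $m$.
   Context: Irrational real numbers $s = [s_0; s_1, \dots]$ and $t = [t_0; t_1, \dots]$ (simple continued fractions) have common tails if there exist $i, j \ge 0$ with $s_{i+l} = t_{j+l}$ for all $l \ge 0$. *)

(* Defs.v *)
From mathcomp Require Import all_boot all_order all_algebra.
From mathcomp Require Import all_classical reals.

Set Implicit Arguments.
Unset Strict Implicit.
Unset Printing Implicit Defensive.

Import Order.TTheory GRing.Theory Num.Theory.
Local Open Scope ring_scope.

(* The i-th complete quotient of s: the quotients of an irrational s are again
   irrational, so the fractional part is nonzero at every step; for rational s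
   the convention 0^-1 = 0 makes the values eventually 0. *)
Fixpoint complete_quotient (R : realType) (s : R) (i : nat) : R :=
  if i is i'.+1 then
    let x := complete_quotient s i' in (x - (Num.floor x)%:~R)^-1
  else s.

(* The partial quotient s_i in s = [s_0; s_1, ...], with s irrational. *)
Definition partial_quotient (R : realType) (s : R) (i : nat) : int :=
  Num.floor (complete_quotient s i).

Definition common_tails (R : realType) (s t : R) : Prop :=
  [/\ irrational s, irrational t &
      exists i j : nat, forall l : nat,
        partial_quotient s (i + l) = partial_quotient t (j + l)].

(* Main.v *)
(** Numbers with common tails are related by a Moebius transformation in
    GL_2(Z).  If such a transformation maps one root of [q] to another, it maps
    every root to a root, so the transformations preserving the roots induce a
    group of permutations, transitive on the [n] roots.  For [n >= 3] it is
    also free, since a non-scalar transformation fixes only numbers of degree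
    at most 2; hence its order is [n].  By Cauchy's theorem each prime [p]
    dividing [n] is the order of an element of PGL_2(Z).  The powers of an
    integer matrix of determinant 1 or -1 are governed by a Lucas sequence,
    which can only vanish at a positive index when the matrix has order at most
    3 in PGL_2(Z), so [p] is 2 or 3. *)

Require Import Defs.
From mathcomp Require Import all_boot all_order all_algebra.
From mathcomp Require Import all_fingroup all_solvable.
From mathcomp Require Import all_classical reals.
From mathcomp Require Import zify ring lra.

Set Implicit Arguments.
Unset Strict Implicit.
Unset Printing Implicit Defensive.

Import Order.TTheory GRing.Theory Num.Theory.
Local Open Scope ring_scope.

(** * Continued fractions: the partial quotients determine an irrational number *)

Lemma irrational_neq_ratr (R : realType) (x : R) (a : rat) :
  irrational x -> x != ratr a.
Proof. by move=> irrx; apply/eqP => xa; apply: irrx; exists a. Qed.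

Lemma irrational_neq_int (R : realType) (x : R) (m : int) :
  irrational x -> x != m%:~R.
Proof. by move=> irrx; rewrite -ratr_int irrational_neq_ratr. Qed.

Lemma complete_quotient_irrational (R : realType) (x : R) i :
  irrational x -> irrational (complete_quotient x i).
Proof.
move=> irrx; elim: i => //= i + [a _ eq_a]; apply.
set y := complete_quotient x i in eq_a *.
exists ((Num.floor y)%:~R + a^-1) => //.
by rewrite rmorphD fmorphV /= eq_a ratr_int invrK subrKC.
Qed.

Lemma complete_quotientD (R : realType) (x : R) i l :
  complete_quotient x (i + l) = complete_quotient (complete_quotient x i) l.
Proof. by elim: l => [|l IHl]; rewrite ?addn0 ?addnS //= IHl. Qed.

Lemma complete_quotientE (R : realType) (x : R) i : irrational x ->
  complete_quotient x i =
    (partial_quotient x i)%:~R + (complete_quotient x i.+1)^-1.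
Proof. by move=> irrx; rewrite /= invrK /partial_quotient; ring. Qed.

Lemma complete_quotient_gt1 (R : realType) (x : R) i : irrational x ->
  1 < complete_quotient x i.+1.
Proof.
move=> /(@complete_quotient_irrational _ _ i) irrx /=.
set y := complete_quotient x i in irrx *.
have /andP[ly uy] := floor_itv y.
have : y != (Num.floor y)%:~R by apply: irrational_neq_int.
rewrite intrD in uy; move=> neq_y.
have y_gt : (Num.floor y)%:~R < y by rewrite lt_neqAle eq_sym neq_y.
by rewrite invf_gt1; lra.
Qed.

Lemma partial_quotientS_ge1 (R : realType) (x : R) i : irrational x ->
  1 <= partial_quotient x i.+1.
Proof.
by move=> irrx; rewrite /partial_quotient floor_ge_int ltW ?complete_quotient_gt1.
Qed.

(* Two steps of the expansion shrink the distance by a factor 4. *)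
Lemma partial_quotient_dist (R : realType) (k : nat) (x y : R) :
  irrational x -> irrational y -> partial_quotient x =1 partial_quotient y ->
  k.+1%:R * `|x - y| <= 1.
Proof.
elim: k x y => [|k IHk] x y irrx irry eq_pq.
  rewrite mul1r ltW //.
  have /andP[lx ux] := floor_itv x; have /andP[ly uy] := floor_itv y.
  have := eq_pq 0; rewrite /partial_quotient /= => eq0.
  by rewrite eq0 !intrD in lx ux uy; rewrite real_ltr_norml ?num_real //; lra.
have := complete_quotientE 0 irrx; have := complete_quotientE 1 irrx.
have := complete_quotientE 0 irry; have := complete_quotientE 1 irry.
rewrite -!eq_pq.
have := partial_quotientS_ge1 0 irrx; rewrite -(ler_int R).
have := complete_quotient_gt1 0 irrx; have := complete_quotient_gt1 1 irrx.
have := complete_quotient_gt1 0 irry; have := complete_quotient_gt1 1 irry.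
have : k.+1%:R * `|complete_quotient x 2 - complete_quotient y 2| <= 1.
  apply: IHk; try exact: complete_quotient_irrational.
  move=> l; have := eq_pq (2 + l)%N.
  by rewrite /partial_quotient !complete_quotientD.
move: (partial_quotient x 0)%:~R (partial_quotient x 1)%:~R => a b.
move: (complete_quotient x 1) (complete_quotient x 2) => x1 x2.
move: (complete_quotient y 1) (complete_quotient y 2) => y1 y2 /=.
move=> IH y2_gt1 y1_gt1 x2_gt1 x1_gt1 b_ge1 y1E yE x1E xE.
have x12 : x1 * x2 = b * x2 + 1 by rewrite x1E; field; lra.
have y12 : y1 * y2 = b * y2 + 1 by rewrite y1E; field; lra.
have x12_ge2 : 2 <= x1 * x2 by nra.
have y12_ge2 : 2 <= y1 * y2 by nra.
(* Unfolding two steps gives [x - y = (x2 - y2) / (x1 * x2 * y1 * y2)]; both [x1 * x2] and [y1 * y2]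
   are at least 2, whence the factor 4. *)
have dE : x2 - y2 = (x - y) * ((x1 * x2) * (y1 * y2)).
  rewrite x12 y12 xE yE x1E y1E; field.
  by rewrite !gt_eqF //=; nra.
have : 4 * `|x - y| <= `|x2 - y2|.
  by rewrite dE normrM mulrC ler_wpM2l // ger0_norm; nra.
have k_ge0 : 0 <= k%:R :> R by [].
have := normr_ge0 (x - y); move: (`|x - y|) (`|x2 - y2|) IH => u v.
rewrite -!natr1; move: k_ge0; move: (k%:R : R) => K.
nra.
Qed.

(** The bound of [partial_quotient_dist] holds for every [k], so the distance is 0 by the
    archimedean property. *)
Lemma partial_quotient_inj (R : realType) (x y : R) :
  irrational x -> irrational y -> partial_quotient x =1 partial_quotient y ->
  x = y.
Proof.
move=> irrx irry eq_pq; apply/eqP; rewrite -subr_eq0 -normr_le0.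
rewrite leNgt; apply/negP => xy_gt0.
have := @archi_boundP R `|x - y|^-1; rewrite invr_ge0 normr_ge0 => /(_ isT).
set k := Num.bound _; rewrite -div1r ltr_pdivrMr // => lt1k.
have := partial_quotient_dist k irrx irry eq_pq.
by rewrite -natr1; lra.
Qed.

(** * Integer Moebius transformations and equivalence under GL_2(Z) *)

Definition unimodular (a b c d : int) : Prop := (a * d - b * c) ^+ 2 = 1.

(* [y = (a x + b) / (c x + d)], cleared of its denominator. *)
Definition moebius (R : realType) (a b c d : int) (x y : R) : Prop :=
  y * (c%:~R * x + d%:~R) = a%:~R * x + b%:~R.

Definition GL2Z_equiv (R : realType) (x y : R) : Prop :=
  exists a b c d : int, unimodular a b c d /\ moebius a b c d x y.

(** The entries are those of a matrix product, and determinants multiply; squaring covers both signs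
    with one equation. *)
Lemma unimodularM a b c d a' b' c' d' :
  unimodular a b c d -> unimodular a' b' c' d' ->
  unimodular (a' * a + b' * c) (a' * b + b' * d)
             (c' * a + d' * c) (c' * b + d' * d).
Proof.
rewrite /unimodular => det1 det1'.
transitivity ((a' * d' - b' * c') ^+ 2 * (a * d - b * c) ^+ 2).
  by ring.
by rewrite det1 det1'.
Qed.

Lemma moebiusM (R : realType) a b c d a' b' c' d' (x y z : R) :
  moebius a b c d x y -> moebius a' b' c' d' y z ->
  moebius (a' * a + b' * c) (a' * b + b' * d)
          (c' * a + d' * c) (c' * b + d' * d) x z.
Proof.
rewrite /moebius !intrD !intrM => xy yz; move: xy yz.
move: (a%:~R) (b%:~R) (c%:~R) (d%:~R) => {}a {}b {}c {}d.
move: (a'%:~R) (b'%:~R) (c'%:~R) (d'%:~R) => {}a' {}b' {}c' {}d' xy yz.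
(* The last summand vanishes by [xy], so the new denominator is the product of the two old ones. *)
have -> : (c' * a + d' * c) * x + (c' * b + d' * d) =
          (c' * y + d') * (c * x + d) + c' * (a * x + b - y * (c * x + d)).
  by ring.
by rewrite xy subrr mulr0 addr0 mulrA yz mulrDl -mulrA xy; ring.
Qed.

(** The adjugate inverts a matrix up to a scalar, which does not affect the transformation. *)
Lemma moebius_inv (R : realType) a b c d (x y : R) :
  moebius a b c d x y -> moebius d (- b) (- c) a y x.
Proof.
rewrite /moebius !mulrNz => xy.
apply/eqP; rewrite -subr_eq0; apply/eqP.
by rewrite -[RHS](subrr (a%:~R * x + b%:~R)) -{2}xy; ring.
Qed.

Lemma GL2Z_equiv_sym (R : realType) (x y : R) :
  GL2Z_equiv x y -> GL2Z_equiv y x.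
Proof.
move=> [a [b [c [d [det1 /moebius_inv xy]]]]].
exists d, (- b), (- c), a; split=> //; rewrite /unimodular -det1; ring.
Qed.

Lemma GL2Z_equiv_trans (R : realType) (x y z : R) :
  GL2Z_equiv x y -> GL2Z_equiv y z -> GL2Z_equiv x z.
Proof.
move=> [a [b [c [d [det1 xy]]]]] [a' [b' [c' [d' [det1' yz]]]]].
do 4!eexists; split; [exact: unimodularM det1 det1' | exact: moebiusM xy yz].
Qed.

Lemma complete_quotient_equiv (R : realType) (x : R) i :
  irrational x -> GL2Z_equiv (complete_quotient x i) x.
Proof.
move=> irrx; elim: i => [|i IHi].
  by exists 1, 0, 0, 1; rewrite /moebius; split => //=; ring.
apply: GL2Z_equiv_trans IHi.
(* The matrix of [x_i = p_i + 1 / x_(i+1)], of determinant -1. *)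
exists (partial_quotient x i), 1, 1, 0.
split; first by rewrite /unimodular; ring.
have := complete_quotient_gt1 i irrx.
by rewrite /moebius (complete_quotientE i irrx) => ?; field; lra.
Qed.

(** Equal tails force two complete quotients to coincide, and each number is equivalent to its
    complete quotients. *)
Lemma common_tails_equiv (R : realType) (x y : R) :
  common_tails x y -> GL2Z_equiv x y.
Proof.
move=> [irrx irry [i [j eq_pq]]].
apply: GL2Z_equiv_trans (complete_quotient_equiv j irry).
apply: GL2Z_equiv_sym.
have <- : complete_quotient x i = complete_quotient y j.
  apply: partial_quotient_inj; try exact: complete_quotient_irrational.
  by move=> l; move: (eq_pq l); rewrite /partial_quotient !complete_quotientD.
exact: complete_quotient_equiv.
Qed.

Lemma unimodular_cases a b c d :
  unimodular a b c d -> a * d - b * c = 1 \/ a * d - b * c = -1.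
Proof. by move/eqP; rewrite sqrf_eq1 => /orP[] /eqP; [left | right]. Qed.

Lemma moebius_denom_neq0 (R : realType) a b c d (x : R) :
  irrational x -> unimodular a b c d -> c%:~R * x + d%:~R != 0.
Proof.
move=> irrx det1; apply/eqP; have [c0|c0] := eqVneq c 0.
  move/eqP; rewrite c0 mul0r add0r intr_eq0 => /eqP d0.
  by move: det1; rewrite /unimodular c0 d0 !mulr0 subrr expr0n.
move=> cxd0; have c0R : c%:~R != 0 :> R by rewrite intr_eq0.
have xE : x = - d%:~R / c%:~R.
  by apply: (mulfI c0R); rewrite mulrCA divff // mulr1; lra.
have := irrational_neq_ratr (- d%:~R / c%:~R) irrx.
by rewrite fmorph_div rmorphN /= !ratr_int -xE eqxx.
Qed.

Lemma moebius_inj (R : realType) a b c d (x x' y : R) :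
  unimodular a b c d -> moebius a b c d x y -> moebius a b c d x' y -> x = x'.
Proof.
move=> det1 xy x'y.
have : (a * d - b * c)%:~R * (x - x') = 0.
  rewrite intrB !intrM.
  transitivity ((a%:~R * x + b%:~R) * (c%:~R * x' + d%:~R) -
                (a%:~R * x' + b%:~R) * (c%:~R * x + d%:~R)); first by ring.
  by rewrite -xy -x'y; ring.
have det_neq0 : (a * d - b * c)%:~R != 0 :> R.
  by rewrite intr_eq0; case: (unimodular_cases det1) => ->.
by move/eqP; rewrite mulf_eq0 (negPf det_neq0) subr_eq0 => /eqP.
Qed.

(** * Moebius transformations acting on the roots of an irreducible polynomial *)

Lemma irreducible_poly_dvd (R : realType) (q P : {poly rat}) (x : R) :
  irreducible_poly q -> root (map_poly ratr q) x ->
  root (map_poly ratr P) x -> q %| P.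
Proof.
move=> [_ q_irr] qx Px.
have : root (map_poly ratr (gcdp q P)) x by rewrite gcdp_map root_gcd qx.
(* A gcd of size 1 is a nonzero constant and has no root; otherwise irreducibility makes it
   associate to [q]. *)
have [/eqP/size_poly1P[g g0 ->]|sz_g _] := eqVneq (size (gcdp q P)) 1%N.
  by rewrite map_polyC rootC /= fmorph_eq0 (negPf g0).
by rewrite -(eqp_dvdl _ (q_irr _ sz_g (dvdp_gcdl _ _))) dvdp_gcdr.
Qed.

(** The binary form of [q] at [(u, v)]: [v ^ deg q * q (u / v)] without division. *)
Definition homogenize (K : nzRingType) (q u v : {poly K}) : {poly K} :=
  \sum_(k < size q) (q`_k)%:P * u ^+ k * v ^+ ((size q).-1 - k).

Lemma horner_homogenize (K : fieldType) (q u v : {poly K}) (x : K) :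
  v.[x] != 0 ->
  (homogenize q u v).[x] = v.[x] ^+ (size q).-1 * q.[u.[x] / v.[x]].
Proof.
move=> vx; rewrite horner_sum [q.[_]]horner_coef mulr_sumr.
apply: eq_bigr => k _; rewrite !hornerM !horner_exp hornerC expr_div_n.
have lek : (k <= (size q).-1)%N by case: (size q) k => [[]|m []].
by rewrite -[in RHS](subnK lek) exprD; field; rewrite expf_neq0.
Qed.

Lemma map_homogenize (K L : fieldType) (f : {rmorphism K -> L})
    (q u v : {poly K}) :
  map_poly f (homogenize q u v) =
  homogenize (map_poly f q) (map_poly f u) (map_poly f v).
Proof.
rewrite rmorph_sum /homogenize size_map_poly; apply: eq_bigr => k _.
by rewrite !rmorphM !rmorphXn /= map_polyC coef_map.
Qed.

Definition affine_poly (a b : int) : {poly rat} := a%:~R *: 'X + b%:~R%:P.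

Lemma horner_affine_poly (R : realType) a b (x : R) :
  (map_poly ratr (affine_poly a b)).[x] = a%:~R * x + b%:~R.
Proof.
by rewrite rmorphD /= map_polyZ map_polyX map_polyC !hornerE /= !ratr_int.
Qed.

(* [(c x + d) ^ n * q ((a x + b) / (c x + d))] is a rational polynomial in [x],
   so its vanishing at one root of [q] propagates to every root of [q]. *)
Lemma root_moebius (R : realType) (q : {poly rat}) a b c d (x y x' : R) :
  irreducible_poly q -> root (map_poly ratr q) x ->
  root (map_poly ratr q) y -> root (map_poly ratr q) x' ->
  c%:~R * x + d%:~R != 0 -> c%:~R * x' + d%:~R != 0 ->
  moebius a b c d x y ->
  root (map_poly ratr q) ((a%:~R * x' + b%:~R) / (c%:~R * x' + d%:~R)).
Proof.
move=> q_irr qx qy qx' Dx Dx' xy.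
pose P := homogenize q (affine_poly a b) (affine_poly c d).
have PE (z : R) : c%:~R * z + d%:~R != 0 -> (map_poly ratr P).[z] =
    (c%:~R * z + d%:~R) ^+ (size q).-1 *
    (map_poly ratr q).[(a%:~R * z + b%:~R) / (c%:~R * z + d%:~R)].
  move=> Dz; rewrite map_homogenize horner_homogenize ?horner_affine_poly //.
  by rewrite size_map_poly.
have /dvdpP[h Ph] : q %| P.
  apply: irreducible_poly_dvd q_irr qx _.
  by rewrite rootE PE // -xy mulfK // (rootP qy) mulr0.
have := PE _ Dx'; rewrite Ph rmorphM hornerM (rootP qx') mulr0 => /esym/eqP.
by rewrite mulf_eq0 expf_eq0 (negPf Dx') andbF.
Qed.

(** Fixed points are the roots of [c X^2 + (d - a) X - b]. Being divisible by [q], of degree at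
    least 3, this polynomial is zero, so every [y] is fixed. *)
Lemma moebius_fix (R : realType) (q : {poly rat}) a b c d (x y : R) :
  irreducible_poly q -> (3 < size q)%N -> root (map_poly ratr q) x ->
  moebius a b c d x x -> moebius a b c d y y.
Proof.
move=> q_irr sz_q qx xx.
pose P : {poly rat} := 'X * affine_poly c d - affine_poly a b.
have PE (z : R) : (map_poly ratr P).[z] =
    z * (c%:~R * z + d%:~R) - (a%:~R * z + b%:~R) :> R.
  rewrite /P rmorphB rmorphM /= map_polyX hornerD hornerN hornerM hornerX.
  by rewrite !horner_affine_poly.
have q_dvd : q %| P.
  by apply: irreducible_poly_dvd q_irr qx _; rewrite rootE PE xx subrr.
have P0 : P = 0.
  apply: contraTeq q_dvd => P0; apply/negP => /(dvdp_leq P0).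
  rewrite leqNgt => /negP; apply.
  apply: leq_trans sz_q; rewrite ltnS.
  have sz_aff e f : (size (affine_poly e f) <= 2)%N.
    rewrite (leq_trans (size_polyD _ _)) // geq_max.
    rewrite (leq_trans (size_scale_leq _ _)) ?size_polyX //=.
    by rewrite (leq_trans (size_polyC_leq1 _)).
  rewrite (leq_trans (size_polyD _ _)) // geq_max size_polyN.
  rewrite (leq_trans (sz_aff a b)) // andbT.
  by rewrite (leq_trans (size_polyMleq _ _)) // size_polyX; apply: sz_aff.
by rewrite /moebius; apply/eqP; rewrite -subr_eq0 -PE P0 rmorph0 horner0.
Qed.

(** * Lucas sequences and the prime orders of Moebius permutations *)

Fixpoint lucas (t d : int) (k : nat) : int :=
  if k is k1.+1 then
    if k1 is k2.+1 then t * lucas t d k1 - d * lucas t d k2 else 1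
  else 0.

Lemma lucasSS t d k : lucas t d k.+2 = t * lucas t d k.+1 - d * lucas t d k.
Proof. by []. Qed.

Lemma lucasN1_neq0 t k : t != 0 -> lucas t (-1) k.+1 != 0.
Proof.
move=> t0.
(* The sign invariant excludes cancellation: [t * u_(k+1) * u_(k+2) = (t * u_(k+1))^2 + t * u_k *
   u_(k+1)]. *)
suff: lucas t (-1) k.+1 != 0 /\ 0 <= t * lucas t (-1) k * lucas t (-1) k.+1.
  by case.
elim: k => [|k []]; first by rewrite mulr0 mul0r.
rewrite lucasSS; move: (lucas _ _ k) (lucas _ _ k.+1) => u v v0 tuv.
have tv_gt0 : 0 < (t * v) ^+ 2 by rewrite exprn_even_gt0 //= mulf_neq0.
have tvw : 0 < t * v * (t * v - -1 * u) by nra.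
by split; [apply: contraTneq tvw => -> | apply: ltW]; rewrite ?mulr0.
Qed.

Lemma lucas1_neq0 t k : 2 <= `|t| -> lucas t 1 k.+1 != 0.
Proof.
move=> t2; rewrite -normr_gt0.
(* Absolute values increase strictly, as [|u_(k+2)| >= 2 |u_(k+1)| - |u_k|]. *)
suff: `|lucas t 1 k| < `|lucas t 1 k.+1| by apply: le_lt_trans.
elim: k => [|k IHk]; first by [].
rewrite lucasSS mul1r; apply: lt_le_trans (lerB_dist _ _).
rewrite normrM; have := normr_ge0 (lucas t 1 k.+1); nra.
Qed.

(* Cayley-Hamilton: with [M = (a b; c d)] and [u] its Lucas sequence,
   [M ^ k.+1 = u_k.+1 M - det M u_k]. *)
Lemma moebius_iter (R : realType) a b c d (T : finType) (r : T -> R)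
    (s : {perm T}) (u := lucas (a + d) (a * d - b * c)) k i :
  (forall j, moebius a b c d (r j) (r (s j))) ->
  moebius (u k.+1 * a - (a * d - b * c) * u k) (u k.+1 * b)
          (u k.+1 * c) (u k.+1 * d - (a * d - b * c) * u k)
          (r i) (r ((s ^+ k.+1)%g i)).
Proof.
move=> rs; elim: k => [|k IHk].
  by rewrite /u /= !mul1r !mulr0 !subr0 expg1.
rewrite expgSr permM; have := moebiusM IHk (rs _).
rewrite /u lucasSS; move: (lucas _ _ k) (lucas _ _ k.+1) => v w.
by congr (moebius _ _ _ _ _ _); ring.
Qed.

(** The power [u_(k+1) M - det M u_k] fixes every [r i]. Its scalar part cancels from the
    fixed-point equation, and dividing by [u_(k+1)] shows that [M] fixes every [r i]. *)
Lemma moebius_perm_fix (R : realType) a b c d (T : finType) (r : T -> R)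
    (s : {perm T}) k :
  injective r -> (forall j, irrational (r j)) -> unimodular a b c d ->
  (forall j, moebius a b c d (r j) (r (s j))) ->
  (s ^+ k.+1)%g = 1%g -> lucas (a + d) (a * d - b * c) k.+1 != 0 -> s = 1%g.
Proof.
move=> r_inj irr det1 rs sk1 u0; apply/permP => i; rewrite perm1.
have := moebius_iter k i rs; rewrite sk1 perm1 => ii.
apply: r_inj; apply: (mulIf (moebius_denom_neq0 (irr i) det1)).
rewrite rs; move: ii; rewrite /moebius !intrB !intrM.
have : (lucas (a + d) (a * d - b * c) k.+1)%:~R != 0 :> R by rewrite intr_eq0.
move: (_%:~R) => v v0 ii; apply: (mulfI v0); lra.
Qed.

(** At a zero of the Lucas sequence the power of [M] is the nonzero scalar [- det M u_k], which acts
    as the identity. *)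
Lemma moebius_perm_expg1 (R : realType) a b c d (T : finType) (r : T -> R)
    (s : {perm T}) k :
  injective r -> unimodular a b c d ->
  (forall j, moebius a b c d (r j) (r (s j))) ->
  lucas (a + d) (a * d - b * c) k.+1 = 0 ->
  lucas (a + d) (a * d - b * c) k != 0 -> (s ^+ k.+1)%g = 1%g.
Proof.
move=> r_inj det1 rs u0 v0; apply/permP => i; rewrite perm1.
have := moebius_iter k i rs; rewrite u0 /moebius !mul0r !add0r addr0 => si.
have w0 : (- ((a * d - b * c) * lucas (a + d) (a * d - b * c) k))%:~R != 0 :> R.
  rewrite intr_eq0 oppr_eq0 mulf_neq0 //.
  by case: (unimodular_cases det1) => ->.
by apply: r_inj; apply: (mulIf w0); rewrite [RHS]mulrC -si.
Qed.

Lemma moebius_perm_order (R : realType) a b c d (T : finType) (r : T -> R)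
    (s : {perm T}) :
  injective r -> (forall j, irrational (r j)) -> unimodular a b c d ->
  (forall j, moebius a b c d (r j) (r (s j))) ->
  prime #[s]%g -> #[s]%g \in [:: 2; 3]%N.
Proof.
move=> r_inj irr det1 rs s_pr; rewrite !inE.
have dvd_case k : prime k.+1 -> lucas (a + d) (a * d - b * c) k.+1 = 0 ->
    lucas (a + d) (a * d - b * c) k != 0 -> #[s]%g == k.+1.
  move=> k_pr u0 v0; rewrite -dvdn_prime2 // order_dvdn.
  by rewrite (moebius_perm_expg1 r_inj det1 rs u0 v0).
(* A nonzero Lucas term at the order of [s] would make [s] trivial. *)
have never k : #[s]%g = k.+1 -> lucas (a + d) (a * d - b * c) k.+1 = 0.
  move=> sk; apply/eqP/negPn/negP => u0.
  have s1 := moebius_perm_fix r_inj irr det1 rs _ u0.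
  by move: s_pr; rewrite s1 ?order1 // -sk expg_order.
have s_gt0 := prime_gt0 s_pr.
have {never} := never _ (esym (prednK s_gt0)).
(* Trace 0 means [u_2 = 0], hence order 2. *)
have [t0 _|t0] := eqVneq (a + d) 0.
  by rewrite (dvd_case 1%N) //= t0 mul0r mulr0 subr0.
case: (unimodular_cases det1) => det_eq; rewrite det_eq in dvd_case *; last first.
  by move/eqP; rewrite (negPf (lucasN1_neq0 _ t0)).
have [t2|t_lt2] := leP 2 `|a + d|.
  by move/eqP; rewrite (negPf (lucas1_neq0 _ t2)).
(* What remains is determinant 1 and trace 1 or -1, where [u_3 = t^2 - 1 = 0] gives order 3. *)
move=> _; rewrite (dvd_case 2%N) ?orbT //=; last by rewrite mulr1 mulr0 subr0.
have [->|->] : a + d = 1 \/ a + d = -1 by lia.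
all: by [].
Qed.

(** * The regular permutation group induced on the roots *)

Definition moebius_perms (R : realType) (T : finType) (r : T -> R) :
    {set {perm T}} :=
  [set s : {perm T} | `[< exists a b c d : int, unimodular a b c d /\
                 forall i, moebius a b c d (r i) (r (s i)) >]].

Lemma moebius_permsP (R : realType) (T : finType) (r : T -> R) (s : {perm T}) :
  reflect (exists a b c d : int, unimodular a b c d /\
             forall i, moebius a b c d (r i) (r (s i)))
          (s \in moebius_perms r).
Proof. by rewrite inE; apply: asboolP. Qed.

Lemma moebius_perms_group_set (R : realType) (T : finType) (r : T -> R) :
  group_set (moebius_perms r).
Proof.
apply/group_setP; split=> [|s s'].
  apply/moebius_permsP; exists 1, 0, 0, 1; split=> // i.
  by rewrite /moebius perm1; ring.
move=> /moebius_permsP[a [b [c [d [det1 rs]]]]].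
move=> /moebius_permsP[a' [b' [c' [d' [det1' rs']]]]].
apply/moebius_permsP; do 4!eexists; split; first exact: unimodularM det1 det1'.
by move=> i; rewrite permM; apply: moebiusM (rs i) (rs' _).
Qed.

Canonical moebius_perms_group (R : realType) (T : finType) (r : T -> R) :=
  Group (moebius_perms_group_set r).

Lemma root_of_all_roots (R : realType) n (p : {poly R}) (r : 'I_n -> R) (y : R) :
  size p = n.+1 -> injective r -> (forall i, root p (r i)) -> root p y ->
  exists i, y = r i.
Proof.
move=> sz_p r_inj pr py.
suff /mapP[i _ ->] : y \in [seq r i | i <- enum 'I_n] by exists i.
apply/negPn/negP => y_notin.
have p0 : p != 0 by rewrite -size_poly_gt0 sz_p.
have := max_poly_roots p0 (_ : all (root p) (y :: map r (enum 'I_n))).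
rewrite /= py y_notin map_inj_uniq // enum_uniq size_map size_enum_ord sz_p.
rewrite ltnn => no_roots; suff: false by [].
by apply: no_roots => //; apply/allP => _ /mapP[i _ ->].
Qed.

(** A matrix taking one root to another sends every root to a root by [root_moebius]; being
    injective on a finite set, it induces a permutation. *)
Lemma moebius_perms_transitive (R : realType) n (q : {poly rat})
    (r : 'I_n -> R) (i j : 'I_n) :
  irreducible_poly q -> size q = n.+1 -> injective r ->
  (forall k, irrational (r k)) -> (forall k, root (map_poly ratr q) (r k)) ->
  GL2Z_equiv (r i) (r j) -> exists2 s, s \in moebius_perms r & s i = j.
Proof.
move=> q_irr sz_q r_inj irr q_r [a [b [c [d [det1 ij]]]]].
have Dr k := moebius_denom_neq0 (irr k) det1.
have /choice[f fE] k : exists l, moebius a b c d (r k) (r l).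
  have := root_moebius q_irr (q_r i) (q_r j) (q_r k) (Dr i) (Dr k) ij.
  move/root_of_all_roots => /(_ n r) [||//|l lE]; rewrite ?size_map_poly //.
  by exists l; rewrite /moebius -lE divfK.
have f_inj : injective f.
  move=> k l kl; apply: r_inj.
  by apply: (moebius_inj det1 (fE k)); rewrite kl.
exists (perm f_inj).
  by apply/moebius_permsP; exists a, b, c, d; split=> // k; rewrite permE.
rewrite permE; apply: r_inj; apply: (mulIf (Dr i)).
by rewrite fE ij.
Qed.

Lemma moebius_perms_free (R : realType) n (q : {poly rat})
    (r : 'I_n -> R) (i : 'I_n) (s : 'S_n) :
  irreducible_poly q -> (3 < size q)%N -> injective r ->
  (forall k, irrational (r k)) -> (forall k, root (map_poly ratr q) (r k)) ->
  s \in moebius_perms r -> s i = i -> s = 1%g.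
Proof.
move=> q_irr sz_q r_inj irr q_r /moebius_permsP[a [b [c [d [det1 rs]]]]] si.
have := rs i; rewrite si => ii; apply/permP => j; rewrite perm1.
have jj := moebius_fix (r j) q_irr sz_q (q_r i) ii.
by apply: r_inj; apply: (mulIf (moebius_denom_neq0 (irr j) det1)); rewrite rs jj.
Qed.

(** Evaluation at [i] is a bijection from [G] to ['I_n]: freeness applied to [s * s'^-1] gives
    injectivity, transitivity gives surjectivity. *)
Lemma card_regular n (G : {group 'S_n}) (i : 'I_n) :
  (forall j, exists2 s, s \in G & s i = j) ->
  (forall s, s \in G -> s i = i -> s = 1%g) -> #|G| = n.
Proof.
move=> trG freeG.
rewrite -(@card_in_imset _ _ (fun s : 'S_n => s i)); last first.
  move=> s s' Gs Gs' ss'; apply/eqP; rewrite eq_mulgV1.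
  by rewrite (freeG (s * s'^-1)%g) ?groupM ?groupV // permM ss' permK.
rewrite -[RHS]card_ord -cardsT; apply: eq_card => j; rewrite inE.
by have [s Gs <-] := trG j; apply: imset_f.
Qed.

Lemma prime_divisors_2_3 n :
  (0 < n)%N -> (forall p, prime p -> (p %| n)%N -> p \in [:: 2; 3]%N) ->
  exists k m : nat, n = (2 ^ k * 3 ^ m)%N.
Proof.
move=> n_gt0 n_pr; exists (logn 2 n), (logn 3 n).
rewrite -!p_part -[LHS](partnC 2%N n_gt0); congr (_ * _)%N.
(* The odd part of [n] is its 3-part, since 3 is the only odd prime that can divide [n]. *)
apply: eq_in_partn => p /=; rewrite mem_primes => /and3P[p_pr _ p_dvd].
by have := n_pr p p_pr p_dvd; rewrite !inE => /orP[] /eqP->.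
Qed.

Theorem theorem4p2 (R : realType) (n : nat) (q : {poly rat}) (r : 'I_n -> R)
    (q_irr : irreducible_poly q)
    (q_deg : size q = n.+1)
    (r_inj : injective r)
    (r_root : forall i : 'I_n, root (map_poly ratr q) (r i))
    (r_tails : forall i j : 'I_n, i != j -> common_tails (r i) (r j)) :
  exists k m : nat, n = (2 ^ k * 3 ^ m)%N.
Proof.
have n_gt0 : (0 < n)%N by case: q_irr; rewrite q_deg ltnS.
(* Freeness is available from degree 3 on; 1 and 2 are of the required form. *)
have [n_le2|n_gt2] := leqP n 2.
  case: n n_gt0 n_le2 {q_deg r r_inj r_root r_tails} => [|[|[|n]]] // _ _.
    by exists 0%N, 0%N.
  by exists 1%N, 0%N.
(* Irrationality is read off [common_tails] with any second index [j]. *)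
have irr i : irrational (r i).
  have [j ij] : exists j, i != j.
    apply/existsP; rewrite -negb_forall; apply/negP => /forallP alli.
    have := cardC1 i; rewrite card_ord eq_card0.
      by case: (n) n_gt2 => [|[]].
    by move=> j; rewrite !inE eq_sym (eqP (alli j)) eqxx.
  by have [] := r_tails i j ij.
have equiv i j : GL2Z_equiv (r i) (r j).
  have [->|ij] := eqVneq i j; last exact: common_tails_equiv (r_tails i j ij).
  by exists 1, 0, 0, 1; rewrite /moebius; split=> //; ring.
pose i0 := Ordinal n_gt0.
have cardG : #|moebius_perms r| = n.
  apply: (@card_regular _ [group of moebius_perms r] i0) => [j|s].
    exact: moebius_perms_transitive q_irr q_deg r_inj irr r_root (equiv i0 j).
  by apply: moebius_perms_free q_irr _ r_inj irr r_root; rewrite q_deg.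
apply: prime_divisors_2_3 => // p p_pr; rewrite -{1}cardG.
move=> /(Cauchy p_pr)[s /moebius_permsP[a [b [c [d [det1 rs]]]]] sp].
by rewrite -sp; apply: moebius_perm_order r_inj irr det1 rs _; rewrite sp.
Qed.
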